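(* Let $T$ be a complete $\omega$-stable first-order theory in a countable language with infinite models. Let $\mathbf{C}$ be a class of independence structures containing the forking independence structure $\mathcal{S}_{(\mathcal{M},\,\text{fork})}$ of some $\mathcal{M}\models T$ for which there is a strongly minimal set $F=\phi(\mathcal{M},\emptyset)$ (defined without parameters) such that the pregeometry $(F,\mathrm{cl})$, $\mathrm{cl}(X)=\mathrm{acl}(X)\cap F$, has properties (P1), (P2), (P3). Then for every set $\Sigma$ of independence atoms over $V$ and every independence atom $\phi$ over $V$, $$\Sigma\vdash_{\mathcal{I}}\phi\iff\Sigma\models_{\mathbf{C}}\phi.$$
   Context: Fix a countably infinite set $V$ of variables. Independence atoms $\vec x\perp\vec y$ ($\vec x,\vec y$ finite, possibly empty, sequences from $V$) and derivability $\vdash_{\mathcal{I}}$: the smallest set containing $\Sigma$ closed under (a) $\vec x\perp\emptyset$; (b) $\vec x\perp\vec y\Rightarrow\vec y\perp\vec x$; (c) $\vec x\perp\vec y\vec z\Rightarrow\vec x\perp\vec y$; (d) $\vec x\perp\vec y$ and $\vec x\vec y\perp\vec z$ $\Rightarrow\vec x\perp\vec y\vec z$; (e) for a single variable $x$, $x\perp x\Rightarrow x\perp\vec y$; (f) $\vec x\perp\vec y\Rightarrow\vec u\perp\vec v$ for permutations $\vec u,\vec v$ of $\vec x,\vec y$; (g) $\vec x y\vec z\perp\vec w\Rightarrow\vec x yy\vec z\perp\vec w$. An independence structure is $(I,\perp)$ with $\perp$ a binary relation on finite subsets of $I$ satisfying (I1) $\mathbf{x}\perp\emptyset$; (I2)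 symmetry; (I3) $\mathbf{x}\perp\mathbf{y}\cup\mathbf{z}\Rightarrow\mathbf{x}\perp\mathbf{y}$; (I4) $\mathbf{x}\perp\mathbf{y}$ and $\mathbf{x}\cup\mathbf{y}\perp\mathbf{z}\Rightarrow\mathbf{x}\perp\mathbf{y}\cup\mathbf{z}$; (I5) $\mathbf{x}\perp\mathbf{x}\Rightarrow\mathbf{x}\perp\mathbf{y}$. Assignments $s:V\to I$, $s((x_0,\dots,x_{n-1}))=\{s(x_0),\dots,s(x_{n-1})\}$; $s$ satisfies $\vec x\perp\vec y$ iff $s(\vec x)\perp s(\vec y)$; $\Sigma\models_{\mathbf{C}}\phi$ means every assignment into every structure of $\mathbf{C}$ satisfying $\Sigma$ satisfies $\phi$. Forking independence: for $A,B,C$ subsets of (a model of) $T$, $A\mathrel{\smile\!\!\!\!|}_C B$ iff for every finite tuple $\vec a$ from $A$, $\mathrm{RM}(\mathrm{tp}(\vec a/C\cup B))=\mathrm{RM}(\mathrm{tp}(\vec a/C))$, where RM is Morley rank. The forking independence structure of $\mathcal{M}$ is $(M,\perp)$ with $\mathbf{x}\perp\mathbf{y}$ iff $\mathbf{x}\mathrel{\smile\!\!\!\!|}_{\emptyset}\mathbf{y}$. A definable infinite $D$ is strongly minimal if in every elementary extension every definable subset of (the extension of) $D$ is finite or cofinite. Pregeometry notions: a set is independent if no element is in the closure of the others; $\dim$ is the cardinality of a basis. (P1) $\mathrm{cl}(\emptyset)\neq\emptyset$; (P2) for every finite independent $D_0\subseteq F$, $\mathrm{cl}(D_0)\neq\bigcup_{D\subsetneq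 D_0}\mathrm{cl}(D)$; (P3) $\dim(F)\ge\omega$. *)

(* Defs.v *)
From Stdlib Require List.
From mathcomp Require Import all_boot.
Set Implicit Arguments. Unset Strict Implicit. Unset Printing Implicit Defensive.

Definition atom := (seq nat * seq nat)%type.

Inductive derivable (Sigma : atom -> Prop) : atom -> Prop :=
| d_hyp a : Sigma a -> derivable Sigma a
| d_empty x : derivable Sigma (x, [::])
| d_sym x y : derivable Sigma (x, y) -> derivable Sigma (y, x)
| d_dec x y z : derivable Sigma (x, y ++ z) -> derivable Sigma (x, y)
| d_exch x y z : derivable Sigma (x, y) -> derivable Sigma (x ++ y, z) ->
                 derivable Sigma (x, y ++ z)
| d_const (x : nat) y : derivable Sigma ([:: x], [:: x]) ->
                 derivable Sigma ([:: x], y)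
| d_perm x y u v : derivable Sigma (x, y) -> perm_eq x u -> perm_eq y v ->
                 derivable Sigma (u, v)
| d_dup x (y : nat) z w : derivable Sigma (x ++ y :: z, w) ->
                 derivable Sigma (x ++ y :: y :: z, w).

Definition finite_set (X : Type) (A : X -> Prop) : Prop :=
  exists l : list X, forall x, A x -> List.In x l.
Definition infinite_set (X : Type) (A : X -> Prop) : Prop := ~ finite_set A.
Definition setU (X : Type) (A B : X -> Prop) : X -> Prop := fun x => A x \/ B x.
Definition set0P (X : Type) : X -> Prop := fun _ => False.
Definition countable_set (X : Type) (A : X -> Prop) : Prop :=
  exists f : nat -> X, forall x, A x -> exists k, f k = x.

Definition is_indep_structure (I : Type)
  (ind : (I -> Prop) -> (I -> Prop) -> Prop) : Prop :=
  (forall x, finite_set x -> ind x (@set0P I)) /\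
  (forall x y, finite_set x -> finite_set y -> ind x y -> ind y x) /\
  (forall x y z, finite_set x -> finite_set y -> finite_set z ->
      ind x (setU y z) -> ind x y) /\
  (forall x y z, finite_set x -> finite_set y -> finite_set z ->
      ind x y -> ind (setU x y) z -> ind x (setU y z)) /\
  (forall x y, finite_set x -> finite_set y -> ind x x -> ind x y).

Definition indep_class : Type :=
  forall I : Type, ((I -> Prop) -> (I -> Prop) -> Prop) -> Prop.

Definition simg (I : Type) (s : nat -> I) (xs : seq nat) : I -> Prop :=
  fun i => exists v, v \in xs /\ s v = i.

Definition models_C (C : indep_class) (Sigma : atom -> Prop) (phi : atom) : Prop :=
  forall (I : Type) (ind : (I -> Prop) -> (I -> Prop) -> Prop), C I ind ->
  forall s : nat -> I,
    (forall a, Sigma a -> ind (simg s a.1) (simg s a.2)) ->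
    ind (simg s phi.1) (simg s phi.2).

Record signature := Signature {
  fsym : Type; rsym : Type; far : fsym -> nat; rar : rsym -> nat }.

Definition countable_signature (L : signature) : Prop :=
  (exists f : fsym L -> nat, injective f) /\ (exists g : rsym L -> nat, injective g).

Inductive term (L : signature) : Type :=
| tvar : nat -> term L
| tapp : forall f : fsym L, ('I_(far f) -> term L) -> term L.
Arguments tvar {L}.

Inductive formula (L : signature) : Type :=
| fbot : formula L
| feq : term L -> term L -> formula L
| frel : forall r : rsym L, ('I_(rar r) -> term L) -> formula L
| fimp : formula L -> formula L -> formula L
| fall : nat -> formula L -> formula L.
Arguments fbot {L}.

Record lstructure (L : signature) := MkLStructure {
  dom :> Type;
  fint : forall f : fsym L, ('I_(far f) -> dom) -> dom;
  rint : forall r : rsym L, ('I_(rar r) -> dom) -> Prop }.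

Fixpoint teval (L : signature) (M : lstructure L) (e : nat -> M) (t : term L) : M :=
  match t with
  | tvar n => e n
  | tapp f args => @fint L M f (fun i => teval e (args i))
  end.
Arguments teval {L} M e t.

Definition upd (X : Type) (e : nat -> X) (x : nat) (a : X) : nat -> X :=
  fun k => if k == x then a else e k.

Fixpoint sat (L : signature) (M : lstructure L) (e : nat -> M) (phi : formula L) : Prop :=
  match phi with
  | fbot => False
  | feq t1 t2 => teval M e t1 = teval M e t2
  | frel r args => @rint L M r (fun i => teval M e (args i))
  | fimp a b => sat e a -> sat e b
  | fall x a => forall m : M, sat (upd e x m) a
  end.
Arguments sat {L} M e phi.

Fixpoint tfree (L : signature) (x : nat) (t : term L) : Prop :=
  match t with
  | tvar n => n = x
  | tapp f args => exists i, tfree x (args i)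
  end.

Fixpoint free (L : signature) (x : nat) (phi : formula L) : Prop :=
  match phi with
  | fbot => False
  | feq t1 t2 => tfree x t1 \/ tfree x t2
  | frel r args => exists i, tfree x (args i)
  | fimp a b => free x a \/ free x b
  | fall y a => y <> x /\ free x a
  end.

Definition sentence (L : signature) (phi : formula L) : Prop := forall x, ~ free x phi.

Definition models (L : signature) (M : lstructure L) (T : formula L -> Prop) : Prop :=
  inhabited M /\ forall s, T s -> forall e : nat -> M, sat M e s.
Arguments models {L} M T.

Definition entails (L : signature) (T : formula L -> Prop) (s : formula L) : Prop :=
  forall N : lstructure L, models N T -> forall e : nat -> N, sat N e s.

Definition complete_theory (L : signature) (T : formula L -> Prop) : Prop :=
  (forall s, T s -> sentence s) /\
  (exists N : lstructure L, models N T) /\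
  (forall s, sentence s -> entails T s \/ entails T (fimp s fbot)).

Definition has_infinite_model (L : signature) (T : formula L -> Prop) : Prop :=
  exists N : lstructure L, models N T /\ infinite_set (fun _ : N => True).

Definition elementary (L : signature) (M N : lstructure L) (h : M -> N) : Prop :=
  forall (phi : formula L) (e : nat -> M), sat M e phi <-> sat N (fun k => h (e k)) phi.

(* environment: object variables 0..n-1 from a, parameter variables k >= n from p *)
Definition cat_env (X : Type) (n : nat) (a p : nat -> X) : nat -> X :=
  fun k => if k < n then a k else p k.

Definition params_in (L : signature) (N : lstructure L) (n : nat) (phi : formula L)
  (p : nat -> N) (B : N -> Prop) : Prop :=
  forall k, n <= k -> free k phi -> B (p k).
Arguments params_in {L} N n phi p B.

(* tp(b / A) for b in an elementary extension N' of N, as a set of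
   formulas with parameters (phi, p) (object variable 0, parameters in A) *)
Definition tp1 (L : signature) (N N' : lstructure L) (h : N -> N') (A : N -> Prop)
  (b : N') : formula L * (nat -> N) -> Prop :=
  fun fp => params_in N 1 fp.1 fp.2 A /\
            sat N' (cat_env 1 (fun _ => b) (fun k => h (fp.2 k))) fp.1.

Definition omega_stable (L : signature) (T : formula L -> Prop) : Prop :=
  forall N : lstructure L, models N T ->
  forall A : N -> Prop, countable_set A ->
  exists t : nat -> (formula L * (nat -> N) -> Prop),
    forall (N' : lstructure L) (h : N -> N'), elementary h ->
    forall b : N', exists k, forall fp, tp1 h A b fp <-> t k fp.

(* Brouwer trees: notations for all countable ordinals *)
Inductive bord : Type :=
| bO : bord
| bS : bord -> bord
| bL : (nat -> bord) -> bord.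

(* RMge al N n phi p  :<->  RM(phi(x_0..x_{n-1}; p)) >= al, computed relative
   to N, passing to elementary extensions at successor steps. *)
Fixpoint RMge (L : signature) (al : bord) :
    forall N : lstructure L, nat -> formula L -> (nat -> N) -> Prop :=
  match al with
  | bO => fun N n phi p => exists a : nat -> N, sat N (cat_env n a p) phi
  | bS b => fun N n phi p =>
      exists (N' : lstructure L) (h : N -> N'), elementary h /\
      exists (psi : nat -> formula L) (q : nat -> nat -> N'),
        (forall i j, i <> j -> forall a : nat -> N',
            ~ (sat N' (cat_env n a (q i)) (psi i) /\ sat N' (cat_env n a (q j)) (psi j))) /\
        (forall i (a : nat -> N'), sat N' (cat_env n a (q i)) (psi i) ->
            sat N' (cat_env n a (fun k => h (p k))) phi) /\
        (forall i, @RMge L b N' n (psi i) (q i))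
  | bL f => fun N n phi p => forall k, @RMge L (f k) N n phi p
  end.
Arguments RMge {L} al N n phi p.

Definition tp_RMge (L : signature) (al : bord) (N : lstructure L) (n : nat)
  (a : nat -> N) (B : N -> Prop) : Prop :=
  forall (phi : formula L) (p : nat -> N), params_in N n phi p B ->
    sat N (cat_env n a p) phi -> RMge al N n phi p.
Arguments tp_RMge {L} al N n a B.

(* X |_{emptyset} Y : for every finite tuple a from X,
   RM(tp(a / Y)) = RM(tp(a / emptyset)) *)
Definition fork_indep0 (L : signature) (N : lstructure L) (X Y : N -> Prop) : Prop :=
  forall (n : nat) (a : nat -> N), (forall i, i < n -> X (a i)) ->
  forall al : bord, tp_RMge al N n a Y <-> tp_RMge al N n a (@set0P N).
Arguments fork_indep0 {L} N X Y.

(* F = phi(M, emptyset), phi with only variable 0 free *)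
Definition defF (L : signature) (M : lstructure L) (phi : formula L) : M -> Prop :=
  fun b => sat M (fun _ => b) phi.
Arguments defF {L} M phi b.

Definition strongly_minimal0 (L : signature) (M : lstructure L) (phi : formula L) : Prop :=
  (forall k, free k phi -> k = 0) /\
  infinite_set (defF M phi) /\
  forall (N' : lstructure L) (h : M -> N'), elementary h ->
  forall (psi : formula L) (q : nat -> N'),
    finite_set (fun b => defF N' phi b /\ sat N' (upd q 0 b) psi) \/
    finite_set (fun b => defF N' phi b /\ ~ sat N' (upd q 0 b) psi).
Arguments strongly_minimal0 {L} M phi.

Definition acl (L : signature) (M : lstructure L) (X : M -> Prop) (b : M) : Prop :=
  exists (psi : formula L) (q : nat -> M),
    (forall k, k <> 0 -> free k psi -> X (q k)) /\
    sat M (upd q 0 b) psi /\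
    finite_set (fun c => sat M (upd q 0 c) psi).
Arguments acl {L} M X b.

Definition cl (L : signature) (M : lstructure L) (phi : formula L) (X : M -> Prop) (b : M) : Prop :=
  acl M X b /\ defF M phi b.
Arguments cl {L} M phi X b.

Definition cl_independent (L : signature) (M : lstructure L) (phi : formula L)
  (D : M -> Prop) : Prop :=
  forall d, D d -> ~ cl M phi (fun x => D x /\ x <> d) d.
Arguments cl_independent {L} M phi D.

Definition cl_basis (L : signature) (M : lstructure L) (phi : formula L) (B : M -> Prop) : Prop :=
  (forall b, B b -> defF M phi b) /\ cl_independent M phi B /\
  (forall b, defF M phi b -> cl M phi B b).
Arguments cl_basis {L} M phi B.

Definition P1 (L : signature) (M : lstructure L) (phi : formula L) : Prop :=
  exists b, cl M phi (@set0P M) b.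
Arguments P1 {L} M phi.

Definition P2 (L : signature) (M : lstructure L) (phi : formula L) : Prop :=
  forall D0 : M -> Prop, (forall x, D0 x -> defF M phi x) -> finite_set D0 ->
    cl_independent M phi D0 ->
    exists b, cl M phi D0 b /\
      forall D : M -> Prop, (forall x, D x -> D0 x) -> (exists x, D0 x /\ ~ D x) ->
        ~ cl M phi D b.
Arguments P2 {L} M phi.

Definition P3 (L : signature) (M : lstructure L) (phi : formula L) : Prop :=
  exists B : M -> Prop, cl_basis M phi B /\ infinite_set B.
Arguments P3 {L} M phi.

(* Main.v *)
From Stdlib Require List.
From Stdlib Require Import Classical ClassicalEpsilon.
From Stdlib Require Import FunctionalExtensionality PropExtensionality.
From mathcomp Require Import all_boot.
Require Import Defs.
(** An underivable atom shrinks to an underivable [x _|_ y] all of whose proper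
    subatoms are derivable; its variables are then not constant, i.e. [v _|_ v] is
    not derivable.  If [x] and [y] share a variable, send it to a generic element of
    the strongly minimal set [F] and everything else into [cl 0].  Otherwise send all
    variables of [x y] but one, [x0], to independent elements of [F], send [x0] to an
    element in the closure of these but of no proper subset (P2), and everything else
    into [cl 0] (P1).

    The axioms of independence structures hold in [fork_indep0 M] by hypothesis, so
    forking has to be computed only for a single element [d] against a set [A]:
    [d _|_ A] if [d] lies in [F] but not in [acl A], or if [d] lies in [acl 0];
    and [d _|_ A] fails if [d] lies in [acl A] but not in [acl 0].  This needs only
    to distinguish Morley ranks 0, 1 and at least 2. *)

Set Implicit Arguments. Unset Strict Implicit. Unset Printing Implicit Defensive.

(** * Sets as predicates, and infinite sets *)

Lemma set_ext (X : Type) (A B : X -> Prop) : (forall x, A x <-> B x) -> A = B.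
Proof.
by move=> AB; apply: functional_extensionality => x; apply: propositional_extensionality.
Qed.

Lemma In_nth_ex (X : Type) (d x : X) (l : seq X) :
  List.In x l -> exists2 i, i < size l & nth d l i = x.
Proof.
elim: l => [//|y l IH] /= [->|/IH [i il <-]]; first by exists 0.
by exists i.+1.
Qed.

Lemma infinite_sequence (X : Type) (P : X -> Prop) :
  infinite_set P -> exists f : nat -> X, injective f /\ forall i, P (f i).
Proof.
move=> infP.
have new (l : seq X) : exists x, P x /\ ~ List.In x l.
  apply: NNPP => nex; apply: infP; exists l => x Px.
  by apply: NNPP => nin; apply: nex; exists x.
pose g l := proj1_sig (constructive_indefinite_description _ (new l)).
have gP l : P (g l) /\ ~ List.In (g l) l.
  exact: proj2_sig (constructive_indefinite_description _ (new l)).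
(* [ls n] lists the first [n] choices, so [g (ls n)] differs from all of them. *)
pose ls := fix ls n := if n is m.+1 then g (ls m) :: ls m else [::].
have ls_lt i j : i < j -> List.In (g (ls i)) (ls j).
  elim: j => [//|j IH]; rewrite ltnS leq_eqVlt => /orP [/eqP ->|/IH]; first by left.
  by right.
exists (fun i => g (ls i)); split=> [i j eqg|i]; last by case: (gP (ls i)).
case: (ltngtP i j) => // /ls_lt; first by rewrite eqg => /(proj2 (gP _)).
by rewrite -eqg => /(proj2 (gP _)).
Qed.

(** * Independence structures *)

Definition sing (X : Type) (d : X) : X -> Prop := fun x => d = x.

Lemma finite_sing (X : Type) (d : X) : finite_set (sing d).
Proof. by exists [:: d] => x <-; left. Qed.

Lemma finite_setU (X : Type) (A B : X -> Prop) :
  finite_set A -> finite_set B -> finite_set (setU A B).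
Proof.
move=> [l Al] [m Bm]; exists (l ++ m) => x; rewrite List.in_app_iff.
by move=> [/Al|/Bm]; [left|right].
Qed.

Lemma finite_simg (X : Type) (s : nat -> X) (xs : seq nat) : finite_set (simg s xs).
Proof.
exists (List.map s xs) => x [v [vxs <-]]; apply: List.in_map.
elim: xs vxs => [//|w xs IH]; rewrite inE => /orP [/eqP ->|/IH]; first by left.
by right.
Qed.

Lemma simg_cat (X : Type) (s : nat -> X) (xs ys : seq nat) :
  simg s (xs ++ ys) = setU (simg s xs) (simg s ys).
Proof.
apply: set_ext => i; split.
  by move=> [v [vin <-]]; move: vin; rewrite mem_cat => /orP [vin|vin];
     [left|right]; exists v.
by move=> [[v [vin <-]]|[v [vin <-]]]; exists v; rewrite mem_cat vin ?orbT.
Qed.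

Lemma eq_simg (X : Type) (s : nat -> X) (xs ys : seq nat) :
  xs =i ys -> simg s xs = simg s ys.
Proof.
by move=> eqxy; apply: set_ext => i; split=> -[v [vin <-]]; exists v;
   rewrite ?eqxy // -eqxy.
Qed.

Lemma simg1 (X : Type) (s : nat -> X) v : simg s [:: v] = sing (s v).
Proof.
apply: set_ext => i; split=> [[w [win <-]]|<-]; first by move: win; rewrite inE => /eqP ->.
by exists v; rewrite inE.
Qed.

Lemma simg_nil (X : Type) (s : nat -> X) : simg s [::] = @set0P X.
Proof. by apply: set_ext => i; split=> [[w []]|]. Qed.

Lemma simg_subset (X : Type) (s : nat -> X) (xs ys : seq nat) :
  {subset xs <= ys} -> forall i, simg s xs i -> simg s ys i.
Proof. by move=> sub i [v [/sub vin <-]]; exists v. Qed.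

Section IndepStructure.
Context (I : Type) (ind : (I -> Prop) -> (I -> Prop) -> Prop).
Context (Hind : is_indep_structure ind).

Lemma ind_subr x y y' : finite_set x -> finite_set y -> (forall i, y' i -> y i) ->
  ind x y -> ind x y'.
Proof.
case: Hind => _ [_ [dec _]] fx fy sub xy.
have fy' : finite_set y' by case: fy => l ly; exists l => i /sub /ly.
apply: (dec x y' y) => //.
by have -> : setU y' y = y by apply: set_ext => i; split=> [[/sub|]|]; [| |right].
Qed.

Lemma ind_sub x y x' y' : finite_set x -> finite_set y ->
  (forall i, x' i -> x i) -> (forall i, y' i -> y i) -> ind x y -> ind x' y'.
Proof.
case: (Hind) => _ [sym _] fx fy subx suby xy.
have fy' : finite_set y' by case: fy => l ly; exists l => i /suby /ly.
have fx' : finite_set x' by case: fx => l lx; exists l => i /subx /lx.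
apply: (sym) => //; apply: (ind_subr (y := x)) => //; apply: (sym) => //.
exact: (ind_subr (y := y)).
Qed.

(** By (I5) a constant is independent of [x] and [y] together, so (I4) adjoins it to [y]. *)
Lemma ind_add_const c x y : finite_set x -> finite_set y ->
  ind (sing c) (sing c) -> ind x y -> ind x (setU y (sing c)).
Proof.
case: (Hind) => _ [sym [_ [exch const]]] fx fy cc xy.
have fc := finite_sing c; have fxy := finite_setU fx fy.
by apply: exch => //; apply: sym => //; apply: const.
Qed.

Lemma ind_derivable_sound (s : nat -> I) (Sigma : atom -> Prop) a :
  derivable Sigma a ->
  (forall b, Sigma b -> ind (simg s b.1) (simg s b.2)) ->
  ind (simg s a.1) (simg s a.2).
Proof.
move=> der hyp; have fs := finite_simg s.
case: (Hind) => empty [sym [dec [exch const]]].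
elim: der => /=.
- by move=> b /hyp.
- by move=> x; rewrite simg_nil; apply: empty.
- by move=> x y _; apply: sym.
- by move=> x y z _; rewrite simg_cat; apply: dec.
- by move=> x y z _ xy _; rewrite !simg_cat; apply: exch.
- by move=> x y _; apply: const.
(* Permuting or doubling variables does not change the set of their values. *)
- move=> x y u v _ xy /perm_mem xu /perm_mem yv.
  by rewrite -(eq_simg s xu) -(eq_simg s yv).
- move=> x y z w _; have eqs : x ++ y :: z =i x ++ y :: y :: z.
    by move=> v; rewrite !mem_cat !inE; case: (v == y).
  by rewrite (eq_simg s eqs).
Qed.

(** The constant [c] can be adjoined to either side, so only the variables in [zs] have to be
    checked. *)
Lemma ind_simg_filter (s : nat -> I) c (zs u w : seq nat) :
  (forall v, v \notin zs -> s v = c) -> ind (sing c) (sing c) ->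
  ind (simg s (filter (mem zs) u)) (simg s (filter (mem zs) w)) ->
  ind (simg s u) (simg s w).
Proof.
case: (Hind) => _ [sym _] sc cc uw.
have add xs i : simg s xs i -> setU (simg s (filter (mem zs) xs)) (sing c) i.
  move=> [v [vxs <-]]; case: (boolP (v \in zs)) => [vz|/sc ->]; last by right.
  by left; exists v; rewrite mem_filter vxs andbT.
have fu := finite_simg s (filter (mem zs) u).
have fw := finite_simg s (filter (mem zs) w).
have fwc := finite_setU fw (finite_sing c).
have fuc := finite_setU fu (finite_sing c).
apply: (ind_sub fuc fwc (add u) (add w)); apply: (sym) => //.
by apply: ind_add_const => //; apply: (sym) => //; apply: ind_add_const.
Qed.

(** Induction on [q]: from [p _|_ q] and [v _|_ p q], (I4) gives [p _|_ q v]. This reduces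
    independence of finite sets to that of a single element from a set. *)
Lemma ind_simg_disjoint (s : nat -> I) (zs : seq nat) :
  (forall v q, v \in zs -> {subset q <= zs} -> v \notin q ->
     ind (sing (s v)) (simg s q)) ->
  forall p q, {subset p <= zs} -> {subset q <= zs} -> (forall v, v \in p -> v \notin q) ->
  ind (simg s p) (simg s q).
Proof.
case: (Hind) => empty [sym [_ [exch _]]] single p; have fs := finite_simg s.
elim=> [|v q IH] pz qz pq; first by rewrite simg_nil; apply: empty.
have {}qz' : {subset q <= zs} by move=> w wq; apply: qz; rewrite inE wq orbT.
have {}IH : ind (simg s p) (simg s q).
  by apply: IH => // w /pq; rewrite inE negb_or => /andP [].
have eqs : simg s (v :: q) = setU (simg s q) (sing (s v)).
  rewrite -simg1 -simg_cat; apply: eq_simg => w; rewrite mem_cat !inE; exact: orbC.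
have fv := finite_sing (s v).
case: (boolP (v \in q)) => vq.
  suff -> : simg s (v :: q) = simg s q by [].
  by apply: eq_simg => w; rewrite inE; case: eqP => // ->.
rewrite eqs; apply: exch => //; rewrite -simg_cat; apply: sym => //; apply: single.
- by apply: qz; rewrite inE eqxx.
- by move=> w; rewrite mem_cat => /orP [/pz|/qz'].
- rewrite mem_cat negb_or vq andbT; apply/negP => /pq.
  by rewrite inE eqxx.
Qed.

End IndepStructure.

(** * First-order formulas *)

Definition fand (L : signature) (A B : formula L) := fimp (fimp A (fimp B fbot)) fbot.

Fixpoint fall_below (L : signature) n (psi : formula L) :=
  if n is m.+1 then fall m (fall_below m psi) else psi.

(* The formula [psi(x_0, x_0, .., x_0)], avoiding substitution into terms. *)
Fixpoint fdiag (L : signature) n (psi : formula L) :=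
  if n is m.+1 then fall n (fimp (feq (tvar n) (tvar 0)) (fdiag m psi)) else psi.

(** The equations x_0 = .. = x_{n-1} = x_K. Tuples from a singleton are constant, and this formula
    singles out constant tuples; [K] will be 0 or a parameter position. *)
Fixpoint feqs (L : signature) n K : formula L :=
  if n is m.+1 then fand (feq (tvar m) (tvar K)) (feqs L m K) else fimp fbot fbot.

(** A disjunction written with implications: the tuple is constant, with value one of the [m]
    parameters from position [K] on. *)
Fixpoint fsome (L : signature) n K m : formula L :=
  if m is m'.+1 then fimp (fimp (feqs L n (K + m')) fbot) (fsome L n K m') else fbot.

Section Formulas.
Context (L : signature).
Implicit Types (M N : lstructure L) (psi A B : formula L).

Lemma teval_agree M (e e' : nat -> M) (t : term L) :
  (forall k, tfree k t -> e k = e' k) -> teval M e t = teval M e' t.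
Proof.
elim: t => [n|f args IH] /= ee'; first exact: ee'.
congr fint; apply: functional_extensionality => i; apply: IH => k ki.
by apply: ee'; exists i.
Qed.

Lemma sat_agree M (e e' : nat -> M) psi :
  (forall k, free k psi -> e k = e' k) -> sat M e psi <-> sat M e' psi.
Proof.
elim: psi e e' => [|t u|r args|A IHA B IHB|x A IHA] e e' /= ee' //.
- rewrite (@teval_agree _ e e' t) ?(@teval_agree _ e e' u) // => k kf; apply: ee';
    by [left|right].
- suff -> : (fun i => teval M e (args i)) = (fun i => teval M e' (args i)) by [].
  apply: functional_extensionality => i; apply: teval_agree => k ki.
  by apply: ee'; exists i.
- have hA := IHA e e' (fun k kA => ee' k (or_introl kA)).
  have hB := IHB e e' (fun k kB => ee' k (or_intror kB)).
  by tauto.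
- have h m : sat M (upd e x m) A <-> sat M (upd e' x m) A.
    apply: IHA => k kA; rewrite /upd; case: eqP => // kx.
    by apply: ee'; split=> // xk; case: kx.
  by split=> H m; apply/h.
Qed.

Lemma tfree_bound (t : term L) : exists K, forall k, tfree k t -> k < K.
Proof.
elim: t => [n|f args IH] /=; first by exists n.+1 => k ->.
have [K hK] := fin_all_exists IH; exists (\max_i K i) => k [i ki].
exact: leq_trans (hK i k ki) (leq_bigmax i).
Qed.

Lemma free_bound psi : exists K, forall k, free k psi -> k < K.
Proof.
elim: psi => [|t u|r args|A [K hK] B [K' hK']|x A [K hK]] /=.
- by exists 0.
- have [K hK] := tfree_bound t; have [K' hK'] := tfree_bound u.
  by exists (maxn K K') => k; rewrite leq_max => -[/hK|/hK'] ->; rewrite ?orbT.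
- have [K hK] := fin_all_exists (fun i => tfree_bound (args i)).
  exists (\max_i K i) => k [i ki].
  exact: leq_trans (hK i k ki) (leq_bigmax i).
- by exists (maxn K K') => k; rewrite leq_max => -[/hK|/hK'] ->; rewrite ?orbT.
- by exists K => k [_ /hK].
Qed.

Lemma sat_fand M (e : nat -> M) A B : sat M e (fand A B) <-> sat M e A /\ sat M e B.
Proof. by rewrite /=; have := classic (sat M e A); tauto. Qed.

Lemma free_fand k A B : free k (fand A B) -> free k A \/ free k B.
Proof. by rewrite /=; tauto. Qed.

Lemma sat_fall_below M (e : nat -> M) n psi :
  sat M e (fall_below n psi) <-> forall a, sat M (cat_env n a e) psi.
Proof.
elim: n e => [|n IH] e /=.
  by split=> [H a|/(_ e)].
have eqE (a : nat -> M) m : cat_env n a (upd e n m) = cat_env n.+1 (upd a n m) e.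
  apply: functional_extensionality => k; rewrite /cat_env /upd ltnS.
  by case: ltngtP.
split=> [H a|H m].
  have /IH/(_ a) := H (a n); rewrite eqE.
  suff -> : upd a n (a n) = a by [].
  by apply: functional_extensionality => k; rewrite /upd; case: eqP => // ->.
by apply/IH => a; rewrite eqE.
Qed.

Lemma sat_fdiag M (e : nat -> M) n psi :
  sat M e (fdiag n psi) <-> sat M (cat_env n.+1 (fun _ => e 0) e) psi.
Proof.
elim: n e => [|n IH] e /=.
  suff -> : cat_env 1 (fun _ => e 0) e = e by [].
  by apply: functional_extensionality => -[].
have eqE : cat_env n.+1 (fun _ => e 0) (upd e n.+1 (e 0)) =
           cat_env n.+2 (fun _ => e 0) e.
  apply: functional_extensionality => k; rewrite /cat_env /upd.
  by rewrite (ltnS k n.+1) (leq_eqVlt k); case: (k < n.+1); case: eqP.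
rewrite {1}/upd eqxx; split.
  by move=> /(_ (e 0)); rewrite {1}/upd /= => /(_ erefl)/IH; rewrite {1}/upd /= eqE.
move=> H m; rewrite {1}/upd /= => ->; apply/IH; by rewrite {1}/upd /= eqE.
Qed.

Lemma free_fdiag k n psi : free k (fdiag n psi) -> k <> 0 -> free k psi /\ n < k.
Proof.
move=> + k0; elim: n => [|n IH] /=; first by split=> //; case: k k0 H.
move=> [nk [[nk'|k0']|/IH [fk nk']]].
- by case: nk.
- by case: k0.
- by split=> //; rewrite ltn_neqAle nk' andbT; apply/eqP.
Qed.

Lemma sat_feqs M (e : nat -> M) n K :
  sat M e (feqs L n K) <-> forall j, j < n -> e j = e K.
Proof.
elim: n => [|n IH]; first by split=> [_ j|_ /=].
rewrite [feqs _ _ _]/= sat_fand IH; split=> [[h H] j|H].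
  by rewrite ltnS leq_eqVlt => /orP [/eqP ->|/H].
by split=> [|j jn]; apply: H => //; apply: ltnW.
Qed.

Lemma free_feqs k n K : free k (feqs L n K) -> k < n \/ k = K.
Proof.
elim: n => [|n IH]; first by move=> /= [].
rewrite [feqs _ _ _]/= => /free_fand [/= [<-|<-]|/IH [kn|]]; [by left|by right| |by right].
by left; apply: ltnW.
Qed.

Lemma sat_fsome M (e : nat -> M) n K m :
  sat M e (fsome L n K m) <-> exists2 i, i < m & forall j, j < n -> e j = e (K + i).
Proof.
elim: m => [|m IH]; first by split=> // -[].
rewrite [fsome _ _ _ _]/= [sat _ _ _]/= IH sat_feqs; split=> [H|[i]].
  case: (classic (forall j, j < n -> e j = e (K + m))) => [h|/H [i im hi]].
    by exists m.
  by exists i => //; apply: ltnW.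
by rewrite ltnS leq_eqVlt => /orP [/eqP -> h []|im hi _] //; exists i.
Qed.

Lemma cat_env1 M (a q : nat -> M) : cat_env 1 a q = upd q 0 (a 0).
Proof. by apply: functional_extensionality => -[|k]. Qed.

Lemma cat_env_eq M n (a b q : nat -> M) :
  (forall j, j < n -> a j = b j) -> cat_env n a q = cat_env n b q.
Proof.
by move=> ab; apply: functional_extensionality => k; rewrite /cat_env; case: ltnP => // /ab.
Qed.

(** * Morley rank at most one *)

(* [al <= be] as ordinals, read off from the ranks they define. *)
Definition RMle (al be : bord) : Prop := forall N n psi (p : nat -> N),
  RMge be N n psi p -> RMge al N n psi p.

Lemma RMge_bO_le al : RMle bO al.
Proof.
elim: al => [//|b IH|f IH] N n psi p; last by move=> /(_ 0); apply: IH.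
move=> [N' [h [eh [chi [q [_ [sub rk]]]]]]].
have [a /sub sa] := IH _ _ _ _ (rk 0).
(* Satisfiability descends from [N'] to [N] because quantifying out the object variables turns it
   into a formula in the parameters [p]. *)
have : ~ sat N' (fun k => h (p k)) (fall_below n (fimp psi fbot)).
  by move=> /sat_fall_below /(_ a) /(_ sa).
rewrite -(eh _ p) sat_fall_below => nall; apply: NNPP => nex.
by apply: nall => a' /= sa'; apply: nex; exists a'.
Qed.

Lemma RMle_bS al be : RMle al be -> RMle (bS al) (bS be).
Proof.
move=> le N n psi p [N' [h [eh [chi [q [dis [sub rk]]]]]]].
exists N', h; split=> //; exists chi, q; split=> //; split=> // i; exact: le (rk i).
Qed.

(** [bL f] acts as the supremum of the [f k] and may be 0 or 1. Its case therefore asks whether some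
    [f k] is at least 2 and, failing that, whether some is at least 1. *)
Lemma RMge_trichotomy al :
  RMle al bO \/ (RMle al (bS bO) /\ RMle (bS bO) al) \/ RMle (bS (bS bO)) al.
Proof.
elim: al => [|b IH|f IH]; first by left.
- right; case: IH => [le0|[[_ le1]|le2]].
  + by left; split; apply: RMle_bS => //; apply: RMge_bO_le.
  + by right; apply: RMle_bS.
  + right; apply: RMle_bS => N n psi p /le2.
    by apply: RMle_bS; apply: RMge_bO_le.
- case: (classic (exists k, RMle (bS (bS bO)) (f k))) => [[k le2]|no2].
    by right; right => N n psi p /(_ k) /le2.
  case: (classic (exists k, RMle (bS bO) (f k))) => [[k le1]|no1].
    right; left; split=> N n psi p; last by move=> /(_ k) /le1.
    move=> H i; case: (IH i) => [le0|[[le1' _]|le2]].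
    + by apply: le0; apply: RMge_bO_le H.
    + exact: le1'.
    + by case: no2; exists i.
  left => N n psi p H i; case: (IH i) => [le0|[[_ le1]|le2]]; first exact: le0.
    by case: no1; exists i.
  by case: no2; exists i.
Qed.

Lemma RMge_1_ge_or al : RMle al bO \/ RMle (bS bO) al.
Proof.
case: (RMge_trichotomy al) => [|[[]|le2]]; [by left|by right|right].
by move=> N n psi p /le2; apply: RMle_bS; apply: RMge_bO_le.
Qed.

(** That all solutions are constant tuples with values in [l] is a formula with the entries of [l]
    as parameters. So an elementary extension adds no solutions, and the pigeonhole principle
    excludes infinitely many disjoint satisfiable pieces. *)
Lemma finite_not_RMge1 N n psi (p : nat -> N) (l : seq N) :
  (forall a, sat N (cat_env n a p) psi ->
     exists b, List.In b l /\ forall j, j < n -> a j = b) ->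
  ~ RMge (bS bO) N n psi p.
Proof.
move=> fin [N' [h [eh [chi [q [dis [sub ne]]]]]]].
(* Positions from [K] on are neither object variables nor free in [psi], so [p'] can store the
   entries of [l] there. *)
have [K0 hK0] := free_bound psi; pose K := maxn n K0.
pose p' k := if k < K then p k else nth (p 0) l (k - K).
have p'l i : p' (K + i) = nth (p 0) l i.
  by rewrite /p' ltnNge leq_addr addKn.
have agree (a : nat -> N) : sat N (cat_env n a p') psi <-> sat N (cat_env n a p) psi.
  apply: sat_agree => k /hK0 kK; rewrite /cat_env; case: ifP => // _.
  by rewrite /p' leq_max kK orbT.
have lt_n i : (K + i < n) = false by apply/negbTE;
  rewrite -leqNgt (leq_trans (leq_maxl n K0)) ?leq_addr.
have : sat N p' (fall_below n (fimp psi (fsome L n K (size l)))).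
  apply/sat_fall_below => a /= /agree /fin [b [/(In_nth_ex (p 0)) [i il <-] ab]].
  apply/sat_fsome; exists i => // j jn.
  by rewrite /cat_env jn lt_n ab // p'l.
rewrite (eh _ p') sat_fall_below => tr.
have agree' (a : nat -> N') : sat N' (cat_env n a (fun k => h (p' k))) psi <->
    sat N' (cat_env n a (fun k => h (p k))) psi.
  apply: sat_agree => k /hK0 kK; rewrite /cat_env; case: ifP => // _.
  by rewrite /p' leq_max kK orbT.
have pick (i : 'I_(size l).+1) : exists m : 'I_(size l), exists a,
    sat N' (cat_env n a (q i)) (chi i) /\ forall j, j < n -> a j = h (nth (p 0) l m).
  have [a sa] := ne i; have := tr a; rewrite /= agree' => /(_ (sub _ _ sa)).
  move=> /sat_fsome [m ml hm]; exists (Ordinal ml), a; split=> // j jn.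
  by have := hm j jn; rewrite /cat_env jn lt_n p'l.
have [g gP] := fin_all_exists pick.
(* If [g i = g j], the pieces [i] and [j] share a solution, against disjointness; hence [g] would
   inject [size l + 1] indices into [size l]. *)
suff /leq_card : injective g by rewrite !card_ord ltnn.
move=> i j gij; apply: val_inj; apply: NNPP => nij.
have [a [sa ha]] := gP i; have [b [sb hb]] := gP j.
apply: (dis i j nij a); split=> //.
rewrite (@cat_env_eq _ n a b) // => k kn; by rewrite ha // hb // gij.
Qed.

(** The empty tuple, over which [fork_indep0] also ranges, is the only one of length 0 and cannot
    lie in two disjoint pieces. *)
Lemma arity0_not_RMge1 N psi (p : nat -> N) : ~ RMge (bS bO) N 0 psi p.
Proof.
by apply: (@finite_not_RMge1 _ _ _ _ [:: p 0]) => a _; exists (p 0); split=> //; left.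
Qed.

(** If a formula of the type had finitely many constant solutions, its diagonal would make [d]
    algebraic over [A]. Infinitely many of them give infinitely many disjoint singletons. *)
Lemma not_acl_RMge1 N (A : N -> Prop) d n a :
  ~ acl N A d -> (forall j, j < n.+1 -> a j = d) -> tp_RMge (bS bO) N n.+1 a A.
Proof.
move=> nacl ad psi p par sa.
have inf : infinite_set (fun c => sat N (cat_env n.+1 (fun _ => c) p) psi).
  have sdiag c : sat N (upd p 0 c) (fdiag n psi) <->
                 sat N (cat_env n.+1 (fun _ => c) p) psi.
    rewrite sat_fdiag {1}/upd /=.
    suff -> : cat_env n.+1 (fun _ => c) (upd p 0 c) = cat_env n.+1 (fun _ => c) p by [].
    by apply: functional_extensionality => -[|k].
  move=> fin; apply: nacl; exists (fdiag n psi), p; split; last split.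
  - by move=> k k0 /free_fdiag /(_ k0) [kf nk]; apply: par.
  - by apply/sdiag; rewrite -(@cat_env_eq _ n.+1 a).
  - by case: fin => l hl; exists l => c /sdiag /hl.
have [c [injc cP]] := infinite_sequence inf.
(* Piece [i] is the singleton of the constant tuple [c i]: the second [n.+1] in [feqs] is a
   parameter position, which holds [c i]. *)
exists N, id; split=> //; exists (fun _ => feqs L n.+1 n.+1), (fun i _ => c i).
have solE i (b : nat -> N) : sat N (cat_env n.+1 b (fun _ => c i)) (feqs L n.+1 n.+1) <->
    forall j, j < n.+1 -> b j = c i.
  rewrite sat_feqs /cat_env ltnn.
  by split=> H j jn; have := H j jn; rewrite jn.
split; last split.
- move=> i j nij b [/solE hi /solE hj]; apply: nij; apply: injc.
  by rewrite -(hi 0) // -(hj 0).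
- by move=> i b /solE hb; rewrite (cat_env_eq _ hb).
- by move=> i; exists (fun _ => c i); apply/solE.
Qed.

(** The formula witnessing algebraicity belongs to the type and has finitely many solutions. *)
Lemma acl_not_RMge1 N (A : N -> Prop) d :
  acl N A d -> ~ tp_RMge (bS bO) N 1 (fun _ => d) A.
Proof.
move=> [psi [q [par [sd [l hl]]]]] /(_ psi q).
have par' : params_in N 1 psi q A by case=> // k _; apply: par.
rewrite cat_env1 => /(_ par' sd); apply: (@finite_not_RMge1 _ _ _ _ l) => a.
rewrite cat_env1 => /hl al; exists (a 0); split=> // j.
by rewrite ltnS leqn0 => /eqP ->.
Qed.

(** The formula defines the diagonal copy of [F]. Of two disjoint definable subsets of [F] one is
    finite, so they cannot both have rank at least 1. *)
Lemma strongly_minimal_not_RMge2 M phi n (p : nat -> M) :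
  strongly_minimal0 M phi ->
  ~ RMge (bS (bS bO)) M n.+1 (fand phi (feqs L n.+1 0)) p.
Proof.
move=> [fr [_ sm]] [N [h [eh [psi [q [dis [sub rk]]]]]]].
have solP i (a : nat -> N) : sat N (cat_env n.+1 a (q i)) (psi i) ->
    defF N phi (a 0) /\ forall j, j < n.+1 -> a j = a 0.
  move=> /sub; rewrite sat_fand sat_feqs => -[sF eqa]; split.
    by apply: (iffLR (sat_agree _)) sF => k /fr ->.
  by move=> j jn; have := eqa j jn; rewrite /cat_env jn.
have sdiag c : sat N (upd (q 0) 0 c) (fdiag n (psi 0)) <->
               sat N (cat_env n.+1 (fun _ => c) (q 0)) (psi 0).
  rewrite sat_fdiag {1}/upd /=.
  suff -> : cat_env n.+1 (fun _ => c) (upd (q 0) 0 c) =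
            cat_env n.+1 (fun _ => c) (q 0) by [].
  by apply: functional_extensionality => -[|k].
have diagE (a : nat -> N) (r : nat -> N) : (forall j, j < n.+1 -> a j = a 0) ->
  cat_env n.+1 a r = cat_env n.+1 (fun _ => a 0) r by apply: cat_env_eq.
(* Piece 0 is finite or cofinite in [F]; in the second case piece 1 lies in its finite
   complement. *)
case: (sm N h eh (fdiag n (psi 0)) (q 0)) => -[l hl].
  apply: (@finite_not_RMge1 _ _ _ _ l) (rk 0) => a sa.
  have [Fa eqa] := solP _ _ sa; exists (a 0); split=> //; apply: hl; split=> //.
  by apply/sdiag; rewrite -diagE.
apply: (@finite_not_RMge1 _ _ _ _ l) (rk 1) => a sa.
have [Fa eqa] := solP _ _ sa; exists (a 0); split=> //; apply: hl; split=> //.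
move=> /sdiag; rewrite -diagE // => sa0.
by apply: (dis 0 1 _ a).
Qed.

(** * Forking of a single element over a set *)

Lemma tp_RMge_subset al N n a (A B : N -> Prop) :
  (forall x, A x -> B x) -> tp_RMge al N n a B -> tp_RMge al N n a A.
Proof. by move=> AB tpB psi p par; apply: tpB => k nk /(par k nk) /AB. Qed.

Lemma tp_RMge_bO al N n a (A : N -> Prop) : RMle al bO -> tp_RMge al N n a A.
Proof. by move=> le0 psi p _ sa; apply: le0; exists a. Qed.

(** A nonempty tuple from [sing d] is constant, and its type has rank 1 both over [A] and over the
    empty set: at least 1 by [not_acl_RMge1], at most 1 by strong minimality. *)
Lemma not_acl_fork M phi (A : M -> Prop) d :
  strongly_minimal0 M phi -> defF M phi d -> ~ acl M A d ->
  fork_indep0 M (sing d) A.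
Proof.
move=> sm Fd nacl n a ad al; split; first exact: tp_RMge_subset.
have {}ad j : j < n -> a j = d by move=> /ad.
case: (RMge_1_ge_or al) => [le0 _|ge1 tp0]; first exact: tp_RMge_bO.
case: n ad tp0 => [|n] ad tp0.
  (* The type of the empty tuple contains a valid formula, which in arity 0 does not have rank at
     least 1. *)
  have [] := @arity0_not_RMge1 M (fimp fbot fbot) a.
  by apply: ge1; apply: tp0 => // k _ [].
case: (RMge_trichotomy al) => [le0|[[le1 _]|ge2]]; first exact: tp_RMge_bO.
  by move=> psi p par sa; apply: le1; apply: (not_acl_RMge1 nacl ad).
case: (@strongly_minimal_not_RMge2 M phi n a sm); apply: ge2; apply: tp0.
  move=> k nk /free_fand [/(proj1 sm) k0|/free_feqs [kn|k0]].
  - by rewrite k0 in nk.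
  - by rewrite leqNgt kn in nk.
  - by rewrite k0 in nk.
apply/sat_fand; split.
  by apply: (iffLR (sat_agree _)) Fd => k /(proj1 sm) ->; rewrite /cat_env /= ad.
by apply/sat_feqs => j jn; rewrite /cat_env jn /= !ad.
Qed.

(** Already over the empty set the type contains a formula with finitely many solutions, so its rank
    is 0 and cannot drop. *)
Lemma acl0_fork M (A : M -> Prop) b : acl M (@set0P M) b -> fork_indep0 M (sing b) A.
Proof.
move=> [psi [q [par [sb [l hl]]]]] n a ab al; split; first exact: tp_RMge_subset.
have {}ab j : j < n -> a j = b by move=> /ab.
case: (RMge_1_ge_or al) => [le0 _|ge1 tp0]; first exact: tp_RMge_bO.
case: n ab tp0 => [|n] ab tp0.
  have [] := @arity0_not_RMge1 M (fimp fbot fbot) a.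
  by apply: ge1; apply: tp0 => // k _ [].
have psiE (c : nat -> M) : sat M (cat_env n.+1 c q) psi <-> sat M (upd q 0 (c 0)) psi.
  apply: sat_agree => -[|k] kf //; case: (par k.+1 _ kf) => //.
case: (@finite_not_RMge1 M n.+1 (fand psi (feqs L n.+1 0)) q l).
  move=> c; rewrite sat_fand psiE sat_feqs => -[/hl lc eqc]; exists (c 0); split=> // j jn.
  by have := eqc j jn; rewrite /cat_env jn.
apply: ge1; apply: tp0.
  move=> [//|k] nk /free_fand [kf|/free_feqs [kn|//]]; first by apply: par kf.
  by rewrite leqNgt kn in nk.
apply/sat_fand; split; first by apply/psiE; rewrite ab.
by apply/sat_feqs => j jn; rewrite /cat_env jn /= !ab.
Qed.

(** The type of [d] has rank at least 1 over the empty set, but not over [A]. *)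
Lemma acl_not_fork M (A : M -> Prop) d :
  ~ acl M (@set0P M) d -> acl M A d -> ~ fork_indep0 M (sing d) A.
Proof.
move=> nacl0 aclA /(_ 1 (fun _ => d) (fun _ _ => erefl) (bS bO)) [_ H].
by apply: (acl_not_RMge1 aclA); apply: H; apply: not_acl_RMge1 nacl0 _.
Qed.

Lemma acl_mono M (A B : M -> Prop) d : (forall x, A x -> B x) -> acl M A d -> acl M B d.
Proof.
move=> AB [psi [q [par rest]]]; exists psi, q; split=> // k k0 kf.
by apply: AB; apply: par.
Qed.

End Formulas.

(** * Derivations *)

Section Derivations.
Context (Sigma : atom -> Prop).
Implicit Types x y u w : seq nat.

(** Rule (g) copies the variables of [x'] in front of [x] one by one; decomposition then removes
    [x]. *)
Lemma derivable_subl x y x' :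
  {subset x' <= x} -> derivable Sigma (x, y) -> derivable Sigma (x', y).
Proof.
move=> sub dxy; suff /d_sym/d_dec/d_sym : derivable Sigma (x' ++ x, y) by [].
elim: x' sub => [//|v x' IH] sub /=.
have /IH {}IH : {subset x' <= x} by move=> w wx; apply: sub; rewrite inE wx orbT.
have vin : v \in x' ++ x by rewrite mem_cat sub ?inE ?eqxx ?orbT.
have pv := perm_to_rem vin.
have /(@d_dup _ [::]) d2 := d_perm IH pv (perm_refl y).
by apply: d_perm d2 _ (perm_refl y); rewrite perm_cons perm_sym.
Qed.

Lemma derivable_sub x y x' y' :
  {subset x' <= x} -> {subset y' <= y} ->
  derivable Sigma (x, y) -> derivable Sigma (x', y').
Proof.
by move=> sx sy /(derivable_subl sx)/d_sym/(derivable_subl sy)/d_sym.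
Qed.

(** By (e), [v] is independent of everything, so exchange puts it back. *)
Lemma derivable_rem_const x y v : derivable Sigma ([:: v], [:: v]) ->
  derivable Sigma (rem v x, y) -> derivable Sigma (x, y).
Proof.
move=> /d_const vv /d_sym dxy; apply: d_sym.
apply: (derivable_sub _ _ (d_exch dxy (d_sym (vv _)))) => // w wx.
by rewrite mem_cat inE orbC; case: eqP => //= /eqP wv; apply: rem_mem.
Qed.

(** * Minimal underivable atoms *)

Definition minimal_underivable x y :=
  ~ derivable Sigma (x, y) /\
  forall x' y', {subset x' <= x} -> {subset y' <= y} ->
    size x' + size y' < size x + size y -> derivable Sigma (x', y').

Lemma minimal_underivable_exists x y : ~ derivable Sigma (x, y) ->
  exists x' y', {subset x' <= x} /\ {subset y' <= y} /\ minimal_underivable x' y'.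
Proof.
have [n] := ubnP (size x + size y); elim: n x y => [//|n IH] x y szn nd.
case: (classic (minimal_underivable x y)) => [min|nmin].
  by exists x, y; split=> //; split.
apply: NNPP => nex; apply: nmin; split=> // x' y' sx sy lt.
apply: NNPP => nd'; have [|x1 [y1 [sx1 [sy1 min1]]]] := IH x' y' _ nd'.
  exact: leq_trans lt _.
apply: nex; by exists x1, y1; split=> [v /sx1/sx|] //; split=> // v /sy1/sy.
Qed.

Lemma minimal_underivable_sym x y :
  minimal_underivable x y -> minimal_underivable y x.
Proof.
move=> [nd min]; split=> [/d_sym|y' x' sy sx] //; rewrite addnC [in X in _ < X]addnC => lt.
by apply: d_sym; apply: min.
Qed.

Section Minimal.
Context x y (min_xy : minimal_underivable x y).

(** Rule (g) restores repetitions, so removing one would leave a shorter underivable atom. *)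
Lemma minimal_uniq : uniq x.
Proof.
case: min_xy => nd min; apply: contraT; rewrite -ltn_size_undup => lt; case: nd.
apply: (@derivable_sub (undup x) y) => // [v|]; first by rewrite mem_undup.
by apply: min => // [v|]; rewrite ?mem_undup ?ltn_add2r.
Qed.

Lemma minimal_nonconstl v : v \in x -> ~ derivable Sigma ([:: v], [:: v]).
Proof.
case: min_xy => nd min vx vv; apply: nd; apply: (derivable_rem_const vv).
apply: min => // [w /mem_rem|] //.
by rewrite ltn_add2r size_rem //; case: (x) vx.
Qed.

End Minimal.

Lemma minimal_nonconst x y v : minimal_underivable x y -> v \in x ++ y ->
  ~ derivable Sigma ([:: v], [:: v]).
Proof.
move=> min; rewrite mem_cat => /orP [|]; first exact: (minimal_nonconstl min).
exact: (minimal_nonconstl (minimal_underivable_sym min)).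
Qed.

Lemma minimal_no_overlap x y u w v : minimal_underivable x y -> derivable Sigma (u, w) ->
  v \in x ++ y -> v \in u -> v \notin w.
Proof.
move=> min duw vxy vu; apply/negP => vw; apply: (minimal_nonconst min vxy).
by apply: derivable_sub duw => z; rewrite inE => /eqP ->.
Qed.

(** Otherwise [u] cuts [x] into [x1], [x2] and [y] into [y1], [y2] with [x1 y1 _|_ x2 y2] derivable
    and both sides nonempty. Minimality supplies shorter atoms, and exchange reassembles
    [x _|_ y]. *)
Lemma minimal_no_split x y u w : minimal_underivable x y -> derivable Sigma (u, w) ->
  (forall v, v \in x ++ y -> (v \in u) || (v \in w)) ->
  (forall v, v \in x ++ y -> v \notin u) \/ (forall v, v \in x ++ y -> v \notin w).
Proof.
move=> min duw cov; have ov v := @minimal_no_overlap x y u w v min duw.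
case: (min) => nd mind.
pose x1 := filter (mem u) x; pose x2 := filter (predC (mem u)) x.
pose y1 := filter (mem u) y; pose y2 := filter (predC (mem u)) y.
have sx : size x1 + size x2 = size x by rewrite !size_filter count_predC.
have sy : size y1 + size y2 = size y by rewrite !size_filter count_predC.
have x1s : {subset x1 <= x} by move=> v; rewrite mem_filter => /andP [].
have x2s : {subset x2 <= x} by move=> v; rewrite mem_filter => /andP [].
have y1s : {subset y1 <= y} by move=> v; rewrite mem_filter => /andP [].
have y2s : {subset y2 <= y} by move=> v; rewrite mem_filter => /andP [].
have x12 v : v \in x -> (v \in x1) || (v \in x2).
  by move=> vx; rewrite !mem_filter vx /= !andbT orbN.
have y12 v : v \in y -> (v \in y1) || (v \in y2).
  by move=> vy; rewrite !mem_filter vy /= !andbT orbN.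
have d12 : derivable Sigma (x1 ++ y1, x2 ++ y2).
  apply: derivable_sub duw => v; rewrite mem_cat !mem_filter => /orP [] /andP [] //=.
    by move=> nu vx; have := cov v; rewrite mem_cat vx (negbTE nu) => /(_ isT).
  by move=> nu vy; have := cov v; rewrite mem_cat vy orbT (negbTE nu) => /(_ isT).
have [e1|n1] := posnP (size (x1 ++ y1)).
  left=> v vxy; apply/negP => vu; have : v \in x1 ++ y1.
    by move: vxy; rewrite !mem_cat !mem_filter /= vu.
  by rewrite (size0nil e1).
have [e2|n2] := posnP (size (x2 ++ y2)).
  right=> v vxy; apply: ov => //; apply: contraT => vu; have : v \in x2 ++ y2.
    by move: vxy; rewrite !mem_cat !mem_filter /= vu.
  by rewrite (size0nil e2).
rewrite !size_cat in n1 n2; case: nd.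
have d1 : derivable Sigma (x1, y1).
  by apply: mind => //; rewrite -sx -sy addnACA -[X in X < _]addn0 ltn_add2l.
(* If [x1] is empty, [x _|_ y2] and [y1 _|_ x y2] combine; otherwise [x2 _|_ y] and [x1 _|_ y x2]
   do. *)
have [x10|x1n] := posnP (size x1).
  have y2x : derivable Sigma (x, y2).
    by apply: mind => //; rewrite ltn_add2l -sy -[X in X < _]add0n ltn_add2r; rewrite x10 in n1.
  have y1r : derivable Sigma (y1, x ++ y2).
    have d12' : derivable Sigma (y1 ++ x1, x2 ++ y2).
      by apply: derivable_sub d12 => // v; rewrite !mem_cat orbC.
    apply: (derivable_sub _ _ (d_exch (d_sym d1) d12')) => // v; rewrite !mem_cat.
    by move=> /orP [/x12/orP [] ->|->]; rewrite ?orbT.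
  apply: (derivable_sub _ _ (d_exch y2x (d_sym y1r))) => // v /y12.
  by rewrite mem_cat orbC.
have x2y : derivable Sigma (x2, y).
  by apply: mind => //; rewrite ltn_add2r -sx -[X in X < _]add0n ltn_add2r.
have x1r : derivable Sigma (x1, y ++ x2).
  apply: (derivable_sub _ _ (d_exch d1 d12)) => // v; rewrite !mem_cat.
  by move=> /orP [/y12/orP [] ->|->]; rewrite ?orbT.
apply: d_sym; apply: (derivable_sub _ _ (d_exch (d_sym x2y) (d_sym x1r))) => // v /x12.
by rewrite mem_cat orbC.
Qed.

End Derivations.

(** * Refuting underivable atoms in strongly minimal sets *)

Section Refutation.
Context (L : signature) (M : lstructure L) (phi : formula L).
Context (Hind : is_indep_structure (fork_indep0 M)).
Context (sm : strongly_minimal0 M phi).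
Context (Sigma : atom -> Prop) (x y : seq nat) (min_xy : minimal_underivable Sigma x y).

(** No derivable atom has [v] on both sides, so once [c] is discarded one side is empty. But
    [x _|_ y] would give [d _|_ d], although [d] is algebraic over itself and not over the empty
    set. *)
Lemma refute_overlap v c d : v \in x -> v \in y -> acl M (@set0P M) c ->
  defF M phi d -> ~ acl M (@set0P M) d ->
  exists s : nat -> M, (forall a, Sigma a -> fork_indep0 M (simg s a.1) (simg s a.2)) /\
    ~ fork_indep0 M (simg s x) (simg s y).
Proof.
move=> vx vy aclc Fd nacld; case: (Hind) => empty [sym _].
pose s w := if w == v then d else c; exists s; split.
  move=> [u w] /d_hyp duw /=.
  have nov : v \in u -> v \notin w.
    by apply: minimal_no_overlap min_xy duw _; rewrite mem_cat vx.
  have sc z : z \notin [:: v] -> s z = c by rewrite inE /s => /negbTE ->.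
  apply: (ind_simg_filter Hind sc (acl0_fork _ aclc)).
  apply: (ind_simg_disjoint Hind (zs := [:: v])).
  - move=> z q; rewrite inE => /eqP -> qv vq.
    have -> : q = [::].
      case: q qv vq => [//|z' q] qv; have := qv z'.
      by rewrite !inE eqxx => /(_ isT)/eqP ->; rewrite eqxx.
    rewrite simg_nil; apply: empty; exact: finite_sing.
  - by move=> z; rewrite mem_filter => /andP [].
  - by move=> z; rewrite mem_filter => /andP [].
  - move=> z; rewrite !mem_filter /= => /andP [zv zu]; rewrite zv /=.
    by move: zv zu; rewrite inE => /eqP ->.
move=> sxy; have sv : s v = d by rewrite /s eqxx.
have dd : fork_indep0 M (sing d) (sing d).
  by apply: (ind_sub Hind (finite_simg s x) (finite_simg s y)) sxy => i <-; exists v.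
apply: (acl_not_fork nacld) dd.
exists (feq (tvar 0) (tvar 1)), (fun _ => d); split; last split=> //.
  by move=> k k0 /= [k0'|_]; first by case: k0.
by exists [:: d] => z /=; rewrite /upd /= => ->; left.
Qed.

(** A derivable atom that covers [x y] has all these variables on one side, by [minimal_no_split].
    One that misses a variable is satisfied, since [d] is algebraic only over all of the independent
    elements together. *)
Lemma refute_disjoint c (f : nat -> M) : (forall v, v \in x -> v \notin y) ->
  acl M (@set0P M) c -> injective f -> (forall v, defF M phi (f v)) ->
  (forall v q, v \notin q -> ~ acl M (simg f q) (f v)) -> P2 M phi ->
  exists s : nat -> M, (forall a, Sigma a -> fork_indep0 M (simg s a.1) (simg s a.2)) /\
    ~ fork_indep0 M (simg s x) (simg s y).
Proof.
move=> disj aclc injf Ff indf p2; case: (Hind) => empty [sym [_ [exch _]]].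
have ux := minimal_uniq min_xy; case: (min_xy) => nd _.
case ex : x => [|x0 x'].
  by case: nd; rewrite ex; apply: d_sym; apply: d_empty.
case ey : y => [|y0 y']; first by case: nd; rewrite ey; apply: d_empty.
rewrite -ey; pose zs := x' ++ y.
have x0zs : x0 \notin zs.
  move: ux; rewrite ex /= mem_cat negb_or => /andP [-> _] /=.
  by apply: disj; rewrite ex inE eqxx.
have xyE v : (v \in x ++ y) = (v == x0) || (v \in zs) by rewrite ex.
have y0zs : y0 \in zs by rewrite mem_cat ey inE eqxx orbT.
have [|||d [[acld Fd] nacld]] := p2 (simg f zs).
- by move=> z [w [_ <-]].
- exact: finite_simg.
(* Omitting the value [f w] leaves only values of variables other than [w]. *)
- move=> _ [w [_ <-]] [acld _]; apply: (indf w (filter (predC1 w) zs)).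
    by rewrite mem_filter /= eqxx.
  apply: acl_mono acld => z [[v [vz <-]] nv]; exists v; split=> //.
  by rewrite mem_filter vz andbT /=; apply/eqP => vw; apply: nv; rewrite vw.
pose s v := if v == x0 then d else if v \in zs then f v else c.
have sf v : v \in zs -> s v = f v.
  by move=> vz; rewrite /s vz; case: eqP => // vx0; rewrite -vx0 vz in x0zs.
have sx0 : s x0 = d by rewrite /s eqxx.
have simgE q : {subset q <= zs} -> simg s q = simg f q.
  by move=> qz; apply: set_ext => z; split=> -[v [vq <-]]; exists v; rewrite sf // qz.
(* As [f] is injective, omitting [e] gives a proper subset of the values, over which (P2) keeps [d]
   non-algebraic. *)
have nd_acl q e : {subset q <= zs} -> e \in zs -> e \notin q -> ~ acl M (simg s q) d.
  move=> qz ez eq; rewrite simgE // => acldq.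
  apply: (nacld (simg f q)); last by split.
    exact: simg_subset.
  exists (f e); split; first by exists e.
  by move=> [v [vq /injf ve]]; rewrite -ve vq in eq.
have d_fork q e : {subset q <= zs} -> e \in zs -> e \notin q ->
    fork_indep0 M (sing d) (simg s q).
  by move=> qz ez eq; apply: (not_acl_fork sm Fd (nd_acl q e qz ez eq)).
have f_fork : forall p q, {subset p <= zs} -> {subset q <= zs} ->
    (forall v, v \in p -> v \notin q) -> fork_indep0 M (simg s p) (simg s q).
  apply: (ind_simg_disjoint Hind) => v q vz qz vq.
  by rewrite sf // simgE //; apply: (not_acl_fork sm (Ff v) (indf v q vq)).
have fs := finite_simg s.
(* Adding [d] last to the independent rest makes the exchange property of [cl]
   unnecessary. *)
have add_d p q e : {subset p <= x ++ y} -> {subset q <= zs} ->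
    (forall v, v \in p -> v \notin q) -> e \in zs -> e \notin p -> e \notin q ->
    fork_indep0 M (simg s p) (simg s q).
  move=> pxy qz pq ez ep eq; pose p' := filter (predC1 x0) p.
  have p'z : {subset p' <= zs}.
    by move=> v; rewrite mem_filter /= => /andP [nv /pxy]; rewrite xyE (negbTE nv).
  have qp' : fork_indep0 M (simg s q) (simg s p').
    apply: f_fork => // v vq; apply/negP; rewrite mem_filter => /andP [_ /pq].
    by rewrite vq.
  have fd := finite_sing d; have fp'd := finite_setU (fs p') fd.
  have qp'd : fork_indep0 M (simg s q) (setU (simg s p') (sing d)).
    apply: exch => //; rewrite -simg_cat; apply: (sym) => //; apply: (d_fork _ e) => //.
      by move=> v; rewrite mem_cat => /orP [/qz|/p'z].
    by rewrite mem_cat negb_or eq mem_filter negb_and ep orbT.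
  apply: (sym) => //; apply: (ind_subr Hind (fs q) fp'd) qp'd => i [v [vp <-]].
  case: (v =P x0) => [->|nv]; first by right.
  by left; exists v; rewrite mem_filter /= vp andbT; split=> //; apply/eqP.
exists s; split=> [[u w] /d_hyp duw /=|sxy].
  have sc z : z \notin x ++ y -> s z = c.
    by rewrite xyE negb_or /s => /andP [/negbTE -> /negbTE ->].
  apply: (ind_simg_filter Hind sc (acl0_fork _ aclc)).
  set p := filter _ u; set q := filter _ w.
  have pz : {subset p <= x ++ y} by move=> v; rewrite mem_filter => /andP [].
  have qz : {subset q <= x ++ y} by move=> v; rewrite mem_filter => /andP [].
  have pq v : v \in p -> v \notin q.
    rewrite !mem_filter /= => /andP [vxy vu]; rewrite vxy /=.
    exact: minimal_no_overlap min_xy duw vxy vu.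
  have qp v : v \in q -> v \notin p by move=> vq; apply/negP => /pq; rewrite vq.
  have [cov|/allPn [e exy]] := boolP (all (fun v => (v \in u) || (v \in w)) (x ++ y)).
    have [nu|nw] := minimal_no_split min_xy duw (allP cov).
      have -> : p = [::].
        apply/eqP; rewrite -[_ == _]negbK -has_filter.
        by apply/negP => /hasP [v vu /nu]; rewrite vu.
      by rewrite simg_nil; apply: (sym) => //; exists [::].
    have -> : q = [::].
      apply/eqP; rewrite -[_ == _]negbK -has_filter.
        by apply/negP => /hasP [v vw /nw]; rewrite vw.
    by rewrite simg_nil; apply: empty.
  rewrite negb_or => /andP [eu ew].
  have ep : e \notin p by rewrite mem_filter negb_and eu orbT.
  have eq : e \notin q by rewrite mem_filter negb_and ew orbT.
  have sub_zs r : {subset r <= x ++ y} -> x0 \notin r -> {subset r <= zs}.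
    move=> rxy x0r v vr; have := rxy v vr; rewrite xyE; case: eqP => //= vx0.
    by rewrite -vx0 vr in x0r.
  (* If the missed variable is [x0], only independent elements remain; otherwise [d] is adjoined
     last, on whichever side contains [x0]. *)
  have [ex0|ne] := eqVneq e x0.
    by rewrite ex0 in ep eq; apply: f_fork => //; apply: sub_zs.
  have ez : e \in zs by move: exy; rewrite xyE (negbTE ne).
  have [x0p|x0p] := boolP (x0 \in p).
    by apply: (add_d _ _ e) => //; apply: sub_zs => //; apply: pq.
  by apply: (sym) => //; apply: (add_d _ _ e) => //; apply: sub_zs.
have y0x' : y0 \notin x'.
  by apply/negP => y0x; have := disj y0; rewrite ex ey !inE y0x eqxx orbT => /(_ isT).
(* [x'] misses [y0], so [d] is independent of its values. With [sxy], exchange then makes [d]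
   independent of all values on [zs], over which it is algebraic. *)
have dx' : fork_indep0 M (sing d) (simg s x').
  by apply: (d_fork _ y0) => // v vx; rewrite mem_cat vx.
have dx'y : fork_indep0 M (sing d) (setU (simg s x') (simg s y)).
  apply: exch => //; first exact: finite_sing.
  by move: sxy; rewrite -sx0 -simg1 -simg_cat.
have := dx'y; rewrite -simg_cat simgE //; apply: acl_not_fork => //.
by have := nd_acl [::] y0 _ y0zs; rewrite simg_nil; apply.
Qed.

End Refutation.

(** * Soundness and completeness *)

Theorem theorem4 (L : signature) (T : formula L -> Prop) (C : indep_class)
  (HL : countable_signature L)
  (HT : complete_theory T)
  (Hinf : has_infinite_model T)
  (Hst : omega_stable T)
  (HC : forall (I : Type) (ind : (I -> Prop) -> (I -> Prop) -> Prop),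
          C I ind -> is_indep_structure ind)
  (HM : exists (M : lstructure L) (phi : formula L),
          models M T /\ C (dom M) (fork_indep0 M) /\
          strongly_minimal0 M phi /\ P1 M phi /\ P2 M phi /\ P3 M phi) :
  forall (Sigma : atom -> Prop) (a : atom),
    derivable Sigma a <-> models_C C Sigma a.
Proof.
move=> Sigma [x0 y0]; split=> [der I ind CI s|mod].
  exact: (ind_derivable_sound (HC _ _ CI) der).
case: HM => M [phi [_ [CM [sm [[c [aclc _]] [p2 [B [[FB [indB _]] infB]]]]]]]].
(* The infinite basis from (P3) provides an independent element [f v] for every variable [v]. *)
have Hind := HC _ _ CM; have [f [injf fB]] := infinite_sequence infB.
have Ff v : defF M phi (f v) by apply: FB.
have indf v q : v \notin q -> ~ acl M (simg f q) (f v).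
  move=> vq acl_v; apply: (indB (f v) (fB v)); split=> //.
  apply: acl_mono acl_v => z [w [wq <-]]; split=> // /injf wv.
  by rewrite -wv wq in vq.
apply: NNPP => nd; have [x [y [sx [sy min]]]] := minimal_underivable_exists nd.
(* By monotonicity, an assignment that refutes the minimal subatom also refutes the given atom. *)
suff [s [hyp nxy]] : exists s : nat -> M,
    (forall a, Sigma a -> fork_indep0 M (simg s a.1) (simg s a.2)) /\
    ~ fork_indep0 M (simg s x) (simg s y).
  apply: nxy; apply: (ind_sub Hind (finite_simg s x0) (finite_simg s y0)).
  - exact: simg_subset.
  - exact: simg_subset.
  - exact: (mod _ _ CM s hyp).
have [/hasP [v vx vy]|/hasPn disj] := boolP (has (mem y) x).
  apply: (refute_overlap Hind min vx vy aclc (Ff 0)).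
  by rewrite -(simg_nil f); apply: indf.
exact: (refute_disjoint Hind sm min disj aclc injf Ff indf p2).
Qed.
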